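(* Let $\ell\ge1$ and $i,j\in\{1,\dots,\ell\}$. The adjoint action of the elements $S^C_i\in W^T_{Sp_{2\ell}}\subset Sp_{2\ell}$ on $\mathfrak{sp}_{2\ell}$ satisfies $$\mathrm{Ad}_{S^C_i}(e_j)=\begin{cases} (-1)^{\delta_{i,1}}f_j,& i=j\\ e_j,&|i-j|>1\\ -\mathrm{ad}_{e_i}(e_j),& i-j=-1\\ \frac{1}{|a_{ij}|!}\,\mathrm{ad}_{e_i}^{-a_{ij}}(e_j),& i-j=1\end{cases} \qquad\text{and}\qquad \mathrm{Ad}_{S^C_i}(f_j)=\begin{cases} (-1)^{\delta_{i,1}}e_j,& i=j\\ f_j,&|i-j|>1\\ \mathrm{ad}_{f_i}^{-a_{ij}}(f_j),& i-j=-1\\ \frac{(-1)^{|a_{ij}|}}{|a_{ij}|!}\,\mathrm{ad}_{f_i}^{-a_{ij}}(f_j),& i-j=1.\end{cases}$$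
   Context: $\mathrm{Ad}_g(X)=gXg^{-1}$, $\mathrm{ad}_X(Y)=[X,Y]$, $\delta_{i,1}$ is the Kronecker delta, $e_{ab}$ are the standard $2\ell\times2\ell$ matrix units. $\mathfrak{sp}_{2\ell}=\{X\in\mathfrak{gl}_{2\ell}(\mathbb C): X=-\mathcal S X^\tau\mathcal S^{-1}\}$ and $Sp_{2\ell}=\{g\in GL_{2\ell}(\mathbb C): g=\mathcal S(g^\tau)^{-1}\mathcal S^{-1}\}$, where $(X^\tau)_{ij}=X_{2\ell+1-j,\,2\ell+1-i}$, $\mathcal S=\mathrm{diag}(1,-1,\ldots,1,-1)$. Chevalley generators: $e_1=e_{\ell,\ell+1}$, $f_1=e_{\ell+1,\ell}$, and for $1<k\le\ell$: $e_k=e_{\ell+1-k,\ell+2-k}+e_{\ell+k-1,\ell+k}$, $f_k=e_{\ell+2-k,\ell+1-k}+e_{\ell+k,\ell+k-1}$. Cartan matrix: $a_{ii}=2$, $a_{12}=-1$, $a_{21}=-2$, $a_{i,i+1}=a_{i+1,i}=-1$ for $i\ge2$, $a_{ij}=0$ for $|i-j|>1$. With $T_i$ the diagonal matrix having $-1$ at place $i$ and $1$ elsewhere, $S_i$ the permutation matrix of $(i\;i+1)$ and $\overline S_i=T_iS_iT_i^{-1}$: $S_1^C=T_\ell S_\ell$, $S^C_k=S_{\ell+1-k}\overline S_{\ell-1+k}$ for $1<k\le\ell$. $W^T_{Sp_{2\ell}}$ (the Tits group) is the subgroup of $Sp_{2\ell}$ generated by $\exp\left(\frac\pi2(f_i-e_i)\right)$,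 $1\le i\le\ell$. *)

(* Defs.v *)
(* The complex numbers are R[i] for R : realType. *)
From HB Require Import structures.
From mathcomp Require Import all_boot all_order all_algebra all_fingroup.
From mathcomp Require Import all_classical all_reals all_analysis.
From mathcomp Require Import complex.
Import Order.TTheory GRing.Theory Num.Theory.
Import numFieldNormedType.Exports.

Set Implicit Arguments.
Unset Strict Implicit.
Unset Printing Implicit Defensive.

Local Open Scope classical_set_scope.
Local Open Scope ring_scope.

(* Rows and columns are labelled 1, ..., n as nat: the entry of label (a, b)
   sits at the ordinals of value a.-1 and b.-1. *)

Definition mxunit (K : fieldType) (n a b : nat) : 'M[K]_n :=
  \matrix_(r < n, c < n) ((r.+1 == a) && (c.+1 == b))%:R.

(* The transposition (k k+1) of the labels 1, ..., n, for 1 <= k < n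
   (the identity when k.+1 is out of range). *)
Definition adj_transp (n k : nat) : 'S_n :=
  if (insub k.-1 : option 'I_n) is Some a then
    if (insub k : option 'I_n) is Some b then tperm a b else 1%g
  else 1%g.

Definition Tmx (K : fieldType) (n k : nat) : 'M[K]_n :=
  diag_mx (\row_(r < n) (if r.+1 == k then -1 else 1)).

Definition Smx (K : fieldType) (n k : nat) : 'M[K]_n :=
  perm_mx (adj_transp n k).

Definition Sbarmx (K : fieldType) (n k : nat) : 'M[K]_n :=
  Tmx K n k *m Smx K n k *m invmx (Tmx K n k).

Definition SC (K : fieldType) (l k : nat) : 'M[K]_(2 * l) :=
  if k == 1%N then Tmx K (2 * l) l *m Smx K (2 * l) l
  else Smx K (2 * l) (l + 1 - k) *m Sbarmx K (2 * l) (l - 1 + k).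

(* Transposition with respect to the antidiagonal. *)
Definition atr (K : fieldType) (n : nat) (X : 'M[K]_n) : 'M[K]_n :=
  \matrix_(r < n, c < n) X (rev_ord c) (rev_ord r).

(* diag(1, -1, 1, -1, ...) *)
Definition altmx (K : fieldType) (n : nat) : 'M[K]_n :=
  diag_mx (\row_(r < n) (-1) ^+ r).

Definition sp (K : fieldType) (l : nat) : set 'M[K]_(2 * l) :=
  [set X | X = - (altmx K (2 * l) *m atr X *m invmx (altmx K (2 * l)))].

Definition Sp (K : fieldType) (l : nat) : set 'M[K]_(2 * l) :=
  [set g | g \in unitmx /\
     g = altmx K (2 * l) *m invmx (atr g) *m invmx (altmx K (2 * l))].

Arguments sp K l : clear implicits.
Arguments Sp K l : clear implicits.

Definition chev_e (K : fieldType) (l k : nat) : 'M[K]_(2 * l) :=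
  if k == 1%N then mxunit K (2 * l) l (l + 1)
  else mxunit K (2 * l) (l + 1 - k) (l + 2 - k)
       + mxunit K (2 * l) (l + k - 1) (l + k).

Definition chev_f (K : fieldType) (l k : nat) : 'M[K]_(2 * l) :=
  if k == 1%N then mxunit K (2 * l) (l + 1) l
  else mxunit K (2 * l) (l + 2 - k) (l + 1 - k)
       + mxunit K (2 * l) (l + k) (l + k - 1).

Definition cartan (i j : nat) : int :=
  if i == j then 2
  else if (i == 1%N) && (j == 2%N) then -1
  else if (i == 2%N) && (j == 1%N) then -2
  else if (j == i.+1) || (i == j.+1) then -1
  else 0.

Definition Ad (K : fieldType) (n : nat) (g X : 'M[K]_n) : 'M[K]_n :=
  g *m X *m invmx g.

Definition ad (K : fieldType) (n : nat) (X Y : 'M[K]_n) : 'M[K]_n :=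
  X *m Y - Y *m X.

Definition expmx (K : numFieldType) (n : nat) (A : 'M[K]_n) : 'M[K]_n :=
  lim ((fun N : nat => \sum_(k < N) (k`!%:R^-1 : K) *: A ^+ k) @ \oo).

(* The subgroup of GL_n(K) generated by A, for A a set of invertible matrices. *)
Inductive generated_subgroup (K : fieldType) (n : nat) (A : set 'M[K]_n) :
    'M[K]_n -> Prop :=
| gen_mem g of A g : generated_subgroup A g
| gen_one : generated_subgroup A 1%:M
| gen_mul g h of generated_subgroup A g & generated_subgroup A h :
    generated_subgroup A (g *m h)
| gen_inv g of generated_subgroup A g : generated_subgroup A (invmx g).

Definition tits_group (R : realType) (l : nat) : set 'M[R[i]]_(2 * l) :=
  generated_subgroup
    [set expmx ((pi / 2)%:C%C *: (chev_f R[i] l k - chev_e R[i] l k))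
       | k in [set k : nat | (1 <= k <= l)%N]].

Arguments tits_group R l : clear implicits.

(* Main.v *)
(** [J = f_k - e_k] satisfies [J^3 = - J], so [exp (t J) = 1 + sin t J + (1 - cos t) J^2], which
    at [t = pi/2] is the signed permutation matrix [G_k = 1 + J + J^2].  For [k = 1] this is
    [S_1^C]; for [k > 1], [S_k^C] is [G_k] times a diagonal sign matrix equal to the product
    [G_1^2 ... G_k^2], so it lies in the Tits group.  The adjoint action of a signed permutation
    matrix sends a matrix unit to plus or minus a matrix unit, so the formulas become
    identities between matrix units whose labels are compared by linear arithmetic. *)
Require Import Defs.
From HB Require Import structures.
From mathcomp Require Import all_boot all_order all_algebra all_fingroup.
From mathcomp Require Import all_classical all_reals all_analysis.
From mathcomp Require Import complex.
From mathcomp Require Import zify ring.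
Import Order.TTheory GRing.Theory Num.Theory.
Import numFieldNormedType.Exports.
Local Open Scope classical_set_scope.
Local Open Scope ring_scope.

Set Implicit Arguments.
Unset Strict Implicit.

(** * Exponential of a multiple of a matrix with $J^3=-J$ *)

Section Exponential.
Context (R : realType).

Lemma cvg_real_complex (u : nat -> R) (x : R) :
  u n @[n --> \oo] --> x ->
  (fun n => (u n)%:C%C : (R[i] : numFieldType)) @ \oo --> (x%:C%C : (R[i] : numFieldType)).
Proof.
move=> /cvgrPdist_lt ux; apply/cvgrPdist_lt => e e0.
(* A complex number that is positive in this order is real, which turns the estimate into one over
   [R]. *)
have eE : (complex.Re e)%:C%C = e by exact/RRe_real/gtr0_real.
move: e0; rewrite -eE (ltcR 0) => /ux; apply: filterS => n.
by rewrite -raddfB/= normc_def /= expr0n /= addr0 sqrtr_sqr ltcR.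
Qed.

Lemma exprZmx (K : fieldType) (n : nat) (a : K) (A : 'M[K]_n) (k : nat) :
  (a *: A) ^+ k = a ^+ k *: A ^+ k.
Proof.
elim: k => [|k IH]; first by rewrite !expr0 scale1r.
by rewrite !exprS IH -!mulmxE -scalemxAl -scalemxAr scalerA.
Qed.

(** Exponents start at 1: the pattern would give $-J^2$ at exponent 0, which differs from the
    identity when [J] is singular. *)
Lemma exprS_cube_opp (n : nat) (J : 'M[R[i]]_n) (m : nat) : J ^+ 3 = - J ->
  J ^+ m.+1 = if odd m then (-1) ^+ m./2 *: J ^+ 2 else (-1) ^+ m./2 *: J.
Proof.
move=> J3; elim: m => [|m IH]; first by rewrite expr1 /= expr0 scale1r.
rewrite exprS IH /= uphalf_half; case: (odd m) => /=.
  by rewrite -mulmxE -scalemxAr mulmxE -exprS J3 add1n exprS mulN1r scalerN scaleNr.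
by rewrite -mulmxE -scalemxAr mulmxE -expr2.
Qed.

(** By parity one of the two coefficients is 0. The minus sign comes from $J^{2p}=-(-1)^pJ^2$ for
    $p\ge1$. *)
Lemma exp_term_cube_opp (n : nat) (J : 'M[R[i]]_n) (t : R) (k : nat) : J ^+ 3 = - J ->
  ((k.+1)`!%:R^-1 : R[i]) *: (t%:C%C *: J) ^+ k.+1 =
  (sin_coeff t k.+1)%:C%C *: J - (cos_coeff t k.+1)%:C%C *: J ^+ 2.
Proof.
move=> J3; rewrite exprZmx (@exprS_cube_opp n J k) // scalerA.
have -> : sin_coeff t k.+1 = (~~ odd k)%:R * (-1) ^+ k./2 * t ^+ k.+1 / (k.+1)`!%:R by [].
have -> : cos_coeff t k.+1 = (~~ ~~ odd k)%:R * (-1) ^+ uphalf k * t ^+ k.+1 / (k.+1)`!%:R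
  by [].
have -> : (k.+1)`!%:R^-1 * t%:C%C ^+ k.+1 = (t ^+ k.+1 / (k.+1)`!%:R)%:C%C :> R[i].
  by rewrite mulrC rmorphM /= fmorphV /= rmorph_nat rmorphXn.
have CM a b : (a * b)%:C%C = a%:C%C * b%:C%C :> R[i] by exact: rmorphM.
have CN a : (- a)%:C%C = - a%:C%C :> R[i] by exact: rmorphN.
have sgC m : ((-1) ^+ m)%:C%C = (-1) ^+ m :> R[i] by rewrite rmorphXn rmorphN1.
rewrite -!mulrA; move: (t ^+ k.+1 / _) => x; rewrite negbK /= uphalf_half.
case: (odd k) => /=; rewrite ?mul0r ?mul1r ?scale0r ?sub0r ?subr0 scalerA.
  by rewrite add1n (exprS (-1)) mulN1r mulNr CN scaleNr opprK CM sgC mulrC.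
by rewrite CM sgC mulrC.
Qed.

Lemma expmx_rotation (n : nat) (J : 'M[R[i]]_n) (t : R) : J ^+ 3 = - J ->
  expmx (t%:C%C *: J) = 1 + (sin t)%:C%C *: J + (1 - cos t)%:C%C *: J ^+ 2.
Proof.
move=> J3.
have hsin := @is_cvg_series_sin_coeff R t; have hcos := @is_cvg_series_cos_coeff R t.
have cvs : series (sin_coeff t) n @[n --> \oo] --> sin t.
  by rewrite unlock; exact: hsin.
have cvc : 1 - series (cos_coeff t) n @[n --> \oo] --> 1 - cos t.
  by apply: cvgB; [exact: cvg_cst | rewrite unlock; exact: hcos].
(* The term of index 0 is the identity and [cos_coeff t 0] is 1, so the coefficient of [J ^+ 2] is 1
   minus the cosine sum, which is 0 after one term. *)
have key : forall N, \sum_(k < N.+1) (k`!%:R^-1 : R[i]) *: (t%:C%C *: J) ^+ k =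
   1 + (series (sin_coeff t) N.+1)%:C%C *: J
     + (1 - series (cos_coeff t) N.+1)%:C%C *: J ^+ 2.
  elim=> [|N IH].
    rewrite big_ord1 /series /= !big_nat1 /sin_coeff /cos_coeff /=.
    rewrite !expr0 !mul0r mul1r expr0z fact0 invr1 !mulr1 divr1 subrr.
    by rewrite !raddf0 !scale0r !addr0 scale1r.
  rewrite big_ord_recr /= IH exp_term_cube_opp //.
  rewrite /series /= (big_nat_recr N.+1) //= (big_nat_recr N.+1 _ (cos_coeff t)) //=.
  set s := \sum_(_ <= _ < _) _; set c := \sum_(_ <= _ < _) _.
  rewrite opprD addrA !(raddfD, raddfN) /= !scalerDl !scaleNr.
  by rewrite -addrA addrACA !addrA.
apply: cvg_lim.
  exact: (@norm_hausdorff (R[i] : numFieldType) 'M[R[i]]_n).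
(* [key] covers nonempty partial sums, hence the shift by one before passing to the limit. *)
rewrite -(cvg_shiftS (fun N => _)) /=.
under eq_fun do rewrite key.
apply: cvgD; last first.
  apply: cvgZr_tmp.
  apply: cvg_real_complex.
  rewrite (cvg_shiftS (fun N => 1 - series (cos_coeff t) N)).
  exact: cvc.
apply: cvgD; first exact: cvg_cst.
apply: cvgZr_tmp; apply: cvg_real_complex.
by rewrite (cvg_shiftS (series (sin_coeff t))).
Qed.

End Exponential.

(** * Matrix units and signed permutation matrices *)

Section MatrixUnits.
Context (K : fieldType).
Implicit Types (n l : nat).

(** A unit with a label outside $1,\dots,n$ is the zero matrix, hence the range test on the inner
    label. *)
Lemma mul_mxunit n a b c d : mxunit K n a b *m mxunit K n c d =
  if [&& b == c, (0 < b)%N & (b <= n)%N] then mxunit K n a d else 0.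
Proof.
apply/matrixP => r s; rewrite !mxE.
case: ifP => [/and3P[/eqP <- b0 bn]|h]; rewrite mxE.
  have bn' : (b.-1 < n)%N by lia.
  rewrite (bigD1 (Ordinal bn')) //= !mxE /= prednK // eqxx andbT andTb.
  rewrite big1 ?addr0 => [|k kb]; first by rewrite -natrM mulnb.
  rewrite !mxE (_ : (k.+1 == b) = false) ?andbF ?mul0r //.
  by apply: contraNF kb => /eqP kb; apply/eqP/val_inj; rewrite /= -kb.
apply: big1 => k _; rewrite !mxE.
case: (k.+1 =P b) => [kb|_]; last by rewrite andbF mul0r.
case: (k.+1 =P c) => [kc|_]; last by rewrite mulr0.
by move: h (ltn_ord k); rewrite -kb -kc eqxx /= => ->.
Qed.

Lemma mulmx_mxunitE n (A : 'M[K]_n) (r c d : 'I_n) :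
  (A *m mxunit K n c.+1 d.+1) r d = A r c.
Proof.
rewrite mxE (bigD1 c) //= mxE !eqxx mulr1 big1 ?addr0 // => k kc.
by rewrite mxE eqSS (inj_eq val_inj) (negbTE kc) mulr0.
Qed.

(** Right multiplication by $e_{cd}$ moves column [c] into column [d], so these products determine a
    matrix. *)
Lemma eq_mxunit n (A B : 'M[K]_n) :
  (forall c d, (0 < c <= n)%N -> A *m mxunit K n c d = B *m mxunit K n c d) -> A = B.
Proof.
move=> AB; apply/matrixP => r c.
rewrite -(mulmx_mxunitE A r c c) -(mulmx_mxunitE B r c c) AB //.
exact: (ltn_ord c).
Qed.

(** The [c]-th basis vector goes to [s c] times the [p c]-th one. Units replace basis vectors so
    that [mul_mxunit] applies, and labels stay in [nat] for [lia]. *)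
Definition monomial_action n (g : 'M[K]_n) (s : nat -> K) (p : nat -> nat) :=
  forall c d, (0 < c <= n)%N -> g *m mxunit K n c d = s c *: mxunit K n (p c) d.

Lemma eq_monomial n (g h : 'M[K]_n) s t p q :
  monomial_action g s p -> monomial_action h t q ->
  (forall c, (0 < c <= n)%N -> s c = t c) ->
  (forall c, (0 < c <= n)%N -> p c = q c) -> g = h.
Proof.
by move=> gE hE st pq; apply: eq_mxunit => c d hc; rewrite gE // hE // st // pq.
Qed.

Lemma monomial_mul n (g h : 'M[K]_n) s t p q :
  monomial_action g s p -> monomial_action h t q ->
  (forall c, (0 < c <= n)%N -> (0 < q c <= n)%N) ->
  monomial_action (g *m h) (fun c => t c * s (q c)) (p \o q).
Proof.
move=> gE hE qn c d hc; rewrite -mulmxA hE // -scalemxAr gE ?scalerA //.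
exact: qn.
Qed.

Lemma Ad_mxunit n (g : 'M[K]_n) s p a b :
  g \in unitmx -> monomial_action g s p -> injective p ->
  (forall c, (0 < c <= n)%N -> (0 < p c <= n)%N) ->
  (forall c, s c * s c = 1) ->
  (0 < a <= n)%N -> (0 < b <= n)%N ->
  Ad g (mxunit K n a b) = (s a * s b) *: mxunit K n (p a) (p b).
Proof.
move=> gU gE pI pn ss ha hb.
rewrite /Ad gE // -scalemxAl -scalerA; congr (_ *: _).
(* Factoring out [g] on the right absorbs the inverse; what remains is tested column by column. *)
suff -> : mxunit K n (p a) b = s b *: mxunit K n (p a) (p b) *m g.
  by rewrite mulmxK.
apply: eq_mxunit => c d hc.
rewrite -mulmxA gE // -scalemxAl -scalemxAr !mul_mxunit (inj_eq pI) pn // scalerA.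
rewrite hb !andbT; case: eqVneq => [->|_]; last by rewrite scaler0.
by rewrite ss scale1r.
Qed.

Lemma Tmx_act n k : monomial_action (Tmx K n k) (fun c => if c == k then -1 else 1) id.
Proof.
move=> c d hc; apply/matrixP => r s; rewrite mul_diag_mx !mxE.
by case: (r.+1 =P c) => [->|_] //=; rewrite !mulr0.
Qed.

Lemma Smx_act n k : (0 < k < n)%N -> monomial_action (Smx K n k) (fun=> 1)
  (fun c => if c == k then k.+1 else if c == k.+1 then k else c).
Proof.
move=> hk c d hc; rewrite scale1r /Smx -row_permE.
have k1n : (k.-1 < n)%N by lia. have kn : (k < n)%N by lia.
apply/matrixP => r s; rewrite !mxE; congr ((_ && _)%:R).
rewrite /adj_transp (insubT (fun x => (x < n)%N) k1n) (insubT (fun x => (x < n)%N) kn) /=.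
case: tpermP => [->|->|/eqP]; rewrite /= -?val_eqE /=;
  last move=> r1 /eqP; rewrite -?val_eqE /= => *.
all: repeat case: ifP; lia.
Qed.

(** * Antidiagonal transposition, the symplectic Lie algebra and the symplectic group *)

Lemma atr_mul n (A B : 'M[K]_n) : atr (A *m B) = atr B *m atr A.
Proof.
apply/matrixP => r s; rewrite !mxE (reindex_inj rev_ord_inj).
by apply: eq_bigr => k _; rewrite !mxE mulrC.
Qed.

Lemma atrD n (A B : 'M[K]_n) : atr (A + B) = atr A + atr B.
Proof. by apply/matrixP => r s; rewrite !mxE. Qed.

Lemma atrN n (A : 'M[K]_n) : atr (- A) = - atr A.
Proof. by apply/matrixP => r s; rewrite !mxE. Qed.

Lemma atr1 n : atr (1%:M : 'M[K]_n) = 1%:M.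
Proof.
by apply/matrixP => r s; rewrite !mxE (inj_eq rev_ord_inj) eq_sym.
Qed.

Lemma atr_mxunit n a b : (0 < a <= n)%N -> (0 < b <= n)%N ->
  atr (mxunit K n a b) = mxunit K n (n.+1 - b) (n.+1 - a).
Proof.
move=> ha hb; apply/matrixP => r s; rewrite !mxE; congr (_%:R).
by have := (ltn_ord r, ltn_ord s) => -[] /= ? ?; lia.
Qed.

Lemma altmx_mul n : altmx K n *m altmx K n = 1%:M.
Proof.
rewrite mulmx_diag; apply/matrixP => r s; rewrite !mxE.
by case: eqP => // _; rewrite -exprMn mulrNN mulr1 expr1n.
Qed.

Lemma altmx_unit n : altmx K n \in unitmx.
Proof. by case: (mulmx1_unit (altmx_mul n)). Qed.

Lemma mxunit_altmx n a b : (0 < a)%N -> (0 < b)%N ->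
  mxunit K n a b *m altmx K n = (-1) ^+ (a + b) *: (altmx K n *m mxunit K n a b).
Proof.
move=> a0 b0; apply/matrixP => r s; rewrite mul_mx_diag mul_diag_mx !mxE.
case: (r.+1 =P a) => [<-|_] /=; last by rewrite mul0r !mulr0.
case: (s.+1 =P b) => [<-|_] /=; last by rewrite mul0r !mulr0.
rewrite mul1r mulr1 -exprD (_ : (_ + _ + _ = s + 2 * r.+1)%N); last lia.
by rewrite exprD exprM sqrrN !expr1n mulr1.
Qed.

(** An inverse-free form of membership, which can be checked on matrix units. *)
Lemma sp_altmx l (X : 'M[K]_(2 * l)) :
  sp K l X <-> X *m altmx K (2 * l) = - (altmx K (2 * l) *m atr X).
Proof.
rewrite /sp /=; split=> [{1}-> | h].
  by rewrite mulNmx mulmxKV // altmx_unit.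
by rewrite -mulNmx -h mulmxK // altmx_unit.
Qed.

(** $gDg^\tau=D$ with $D$ invertible exhibits a right inverse of [g], so invertibility is part of
    the equation. *)
Lemma Sp_altmx l (g : 'M[K]_(2 * l)) :
  Sp K l g <-> g *m altmx K (2 * l) *m atr g = altmx K (2 * l).
Proof.
have DU := altmx_unit (2 * l).
split=> [[gU gE] | h].
  have gtU : atr g \in unitmx.
    by case: (@mulmx1_unit _ _ (atr g) (atr (invmx g))); rewrite -?atr_mul ?mulVmx ?atr1.
  by rewrite {1}gE mulmxKV // mulmxKV.
have g1 : g *m (altmx K (2 * l) *m atr g *m invmx (altmx K (2 * l))) = 1%:M.
  by rewrite !mulmxA h mulmxV.
have [gU _] := mulmx1_unit g1; split=> //.
have gtU : atr g \in unitmx.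
  by case: (@mulmx1_unit _ _ (atr g) (atr (invmx g))); rewrite -?atr_mul ?mulVmx ?atr1.
by rewrite -{1}h !mulmxK.
Qed.

Lemma Sp_one l : Sp K l 1%:M.
Proof. by apply/Sp_altmx; rewrite atr1 mul1mx mulmx1. Qed.

Lemma Sp_mul l (g h : 'M[K]_(2 * l)) : Sp K l g -> Sp K l h -> Sp K l (g *m h).
Proof.
move=> /Sp_altmx gE /Sp_altmx hE; apply/Sp_altmx.
by rewrite atr_mul -!mulmxA (mulmxA (altmx _ _)) (mulmxA h) (mulmxA h) hE mulmxA.
Qed.

Lemma Sp_inv l (g : 'M[K]_(2 * l)) : Sp K l g -> Sp K l (invmx g).
Proof.
move=> gS; have [gU _] := gS; move/Sp_altmx: gS => gE; apply/Sp_altmx.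
by rewrite -{1}gE -!mulmxA -atr_mul mulVmx // atr1 mulmx1 mulKmx.
Qed.

Lemma Ad_sp l (g X : 'M[K]_(2 * l)) : Sp K l g -> sp K l X -> sp K l (Ad g X).
Proof.
move=> gS /sp_altmx XE; have [gU _] := gS; apply/sp_altmx.
have /Sp_altmx g'E := Sp_inv gS; move/Sp_altmx: gS => gE.
rewrite /Ad !atr_mul.
(* From $gDg^\tau=D$ follows $g^{-1}D=Dg^\tau$. *)
have -> : g *m X *m invmx g *m altmx K (2 * l) = g *m X *m altmx K (2 * l) *m atr g.
  by rewrite -{1}gE -!mulmxA mulKmx.
rewrite -(mulmxA g X) XE mulmxN mulNmx; congr (- _).
by rewrite -{2}gE -!mulmxA (mulmxA (atr g) (atr (invmx g))) -atr_mul mulVmx // atr1 mul1mx.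
Qed.

(** Moving $D$ across the transpose replaces $J$ by $-J$, so the claim is that $1-J+J^2$ inverts
    $1+J+J^2$. *)
Lemma Sp_quarter_turn l (J : 'M[K]_(2 * l)) : sp K l J -> J ^+ 3 = - J ->
  Sp K l (1%:M + J + J ^+ 2).
Proof.
move=> /sp_altmx JE J3; apply/Sp_altmx; set D := altmx _ _ in JE *.
have DJ : D *m atr J = - (J *m D) by rewrite JE opprK.
have DJ2 : D *m atr (J ^+ 2) = J ^+ 2 *m D.
  by rewrite expr2 -mulmxE atr_mul mulmxA DJ mulNmx -(mulmxA J D) DJ mulmxN opprK mulmxA.
have -> : (1%:M + J + J ^+ 2) *m D *m atr (1%:M + J + J ^+ 2) =
    (1 + J + J ^+ 2) * (1 - J + J ^+ 2) *m D.
  rewrite -mulmxA !atrD atr1 !mulmxDr mulmx1 DJ DJ2 -mulmxE -mulmxA.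
  by rewrite -!mulmxDr; congr (_ *m _); rewrite !mulmxDl mulNmx mul1mx.
(* [(1 + J + J^2)(1 - J + J^2) = 1 + J^2 + J^4]. *)
have J4 : J ^+ 4 = - J ^+ 2 by rewrite exprS J3 mulrN -expr2.
rewrite -[RHS]mul1mx; congr (_ *m D).
rewrite !(mulrDl, mulrDr, mul1r, mulr1, mulrN) -!expr2 -exprS -exprSr -exprM J3 J4.
by move: (J ^+ 2) => P; apply/matrixP => r s; rewrite !mxE; ring.
Qed.

End MatrixUnits.

Ltac decide_if := repeat match goal with |- context [if ?b then _ else _] =>
  first [rewrite (_ : b = true); last by lia | rewrite (_ : b = false); last by lia] end.

(** The four labels are those occurring in $e_k$ and $f_k$. For $k=1$ the two pairs coincide and the
    first matching test decides. *)
Ltac label_cases l k c :=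
  case: (boolP (c == (l.+1 - k)%N)) => ?; [|case: (boolP (c == (l.+2 - k)%N)) => ?;
  [|case: (boolP (c == (l + k).-1)) => ?; [|case: (boolP (c == (l + k)%N)) => ?]]];
  try (exfalso; lia).

(** * The matrices $T_k$ and $\overline S_k$ on basis labels *)

Section SignedTranspositions.
Context (K : fieldType) (n : nat).

Lemma invmx_Tmx k : invmx (Tmx K n k) = Tmx K n k.
Proof.
have TT : Tmx K n k *m Tmx K n k = 1%:M.
  apply: eq_mxunit => c d hc; rewrite -mulmxA Tmx_act // -scalemxAr Tmx_act //.
  by rewrite scalerA mul1mx; case: ifP; rewrite ?mulrNN mulr1 scale1r.
have [TU _] := mulmx1_unit TT.
by rewrite -[LHS]mulmx1 -TT mulKmx.
Qed.

(** Label [k] meets the sign of $T_k$ before the swap, label [k.+1] after it. *)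
Lemma Sbarmx_act k : (0 < k < n)%N -> monomial_action (Sbarmx K n k)
  (fun c => if (c == k) || (c == k.+1) then -1 else 1)
  (fun c => if c == k then k.+1 else if c == k.+1 then k else c).
Proof.
move=> hk c d hc; rewrite /Sbarmx invmx_Tmx -mulmxA Tmx_act // -scalemxAr -mulmxA.
rewrite Smx_act // scale1r Tmx_act; last by do 2? case: ifP; lia.
rewrite scalerA; congr (_ *: _).
case: (boolP (c == k)) => ?; [|case: (boolP (c == k.+1)) => ?]; decide_if.
all: by rewrite ?mulr1 ?mul1r.
Qed.

End SignedTranspositions.

(** * Chevalley generators, their quarter turns and $S^C_k$ on basis labels *)

Section Chevalley.
Context (K : fieldType) (l : nat).
Local Notation E := (mxunit K (2 * l)).

(** A form uniform in [k]: at $k=1$ the second unit would repeat the first and is dropped. *)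
Lemma chev_e_sum k : (1 <= k <= l)%N -> chev_e K l k =
  E (l.+1 - k) (l.+2 - k) + (if k == 1%N then 0 else E (l + k).-1 (l + k)).
Proof.
move=> hk; rewrite /chev_e; case: eqP => [->|k1]; rewrite ?addr0; do 2? congr (_ + _).
all: congr (mxunit _ _ _ _); lia.
Qed.

Lemma chev_f_sum k : (1 <= k <= l)%N -> chev_f K l k =
  E (l.+2 - k) (l.+1 - k) + (if k == 1%N then 0 else E (l + k) (l + k).-1).
Proof.
move=> hk; rewrite /chev_f; case: eqP => [->|k1]; rewrite ?addr0; do 2? congr (_ + _).
all: congr (mxunit _ _ _ _); lia.
Qed.

Lemma mxunit_altmx_odd a b : (0 < a)%N -> (0 < b)%N -> odd (a + b) ->
  E a b *m altmx K (2 * l) = - (altmx K (2 * l) *m E a b).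
Proof.
by move=> a0 b0 ab; rewrite mxunit_altmx // -signr_odd ab expr1 scaleN1r.
Qed.

(** The antidiagonal transpose fixes the unit of $e_1$ and exchanges the two units of $e_k$ for
    $k>1$. Their labels are adjacent, so they anticommute with [altmx]. *)
Lemma chev_e_sp k : (1 <= k <= l)%N -> sp K l (chev_e K l k).
Proof.
move=> hk; apply/sp_altmx; rewrite chev_e_sum //; case: eqP => k1.
  rewrite addr0 atr_mxunit ?mxunit_altmx_odd; [|lia..].
  by congr (- (_ *m mxunit _ _ _ _)); lia.
rewrite atrD !atr_mxunit ?mulmxDl ?mxunit_altmx_odd; [|lia..].
rewrite -opprD -mulmxDr addrC; congr (- (_ *m (_ + _))).
all: by congr (mxunit _ _ _ _); lia.
Qed.

Lemma chev_f_sp k : (1 <= k <= l)%N -> sp K l (chev_f K l k).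
Proof.
move=> hk; apply/sp_altmx; rewrite chev_f_sum //; case: eqP => k1.
  rewrite addr0 atr_mxunit ?mxunit_altmx_odd; [|lia..].
  by congr (- (_ *m mxunit _ _ _ _)); lia.
rewrite atrD !atr_mxunit ?mulmxDl ?mxunit_altmx_odd; [|lia..].
rewrite -opprD -mulmxDr addrC; congr (- (_ *m (_ + _))).
all: by congr (mxunit _ _ _ _); lia.
Qed.

Lemma spB (X Y : 'M[K]_(2 * l)) : sp K l X -> sp K l Y -> sp K l (X - Y).
Proof.
move=> /sp_altmx XE /sp_altmx YE; apply/sp_altmx.
by rewrite mulmxBl XE YE atrD atrN mulmxDr mulmxN opprD opprK.
Qed.

Local Notation J k := (chev_f K l k - chev_e K l k).

(** An infinitesimal rotation in the coordinate planes $\{\ell+1-k,\ell+2-k\}$ and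
    $\{\ell+k-1,\ell+k\}$, a single plane when $k=1$. *)
Lemma chev_diff_act k c d : (1 <= k <= l)%N -> (0 < c <= 2 * l)%N ->
  J k *m E c d =
  if c == (l.+1 - k)%N then E c.+1 d else if c == (l.+2 - k)%N then - E c.-1 d
  else if c == (l + k).-1 then E c.+1 d else if c == (l + k)%N then - E c.-1 d
  else 0.
Proof.
move=> hk hc; rewrite mulmxBl chev_e_sum // chev_f_sum // !mulmxDl.
rewrite !(fun_if (fun A => A *m E c d)) mul0mx !mul_mxunit.
case: (eqVneq k 1%N) => k1; label_cases l k c; decide_if;
  rewrite ?(addr0, add0r, subr0, sub0r, subrr) //.
all: do ? congr (- _); congr (mxunit _ _ _ _); lia.
Qed.

Lemma chev_diff_sqr_act k c d : (1 <= k <= l)%N -> (0 < c <= 2 * l)%N ->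
  J k ^+ 2 *m E c d =
  if [|| c == (l.+1 - k)%N, c == (l.+2 - k)%N, c == (l + k).-1 | c == (l + k)%N]
  then - E c d else 0.
Proof.
move=> hk hc; rewrite expr2 -mulmxE -mulmxA chev_diff_act //.
label_cases l k c; rewrite ?mulmxN ?mulmx0 ?chev_diff_act; try lia.
all: decide_if; rewrite ?opprK //; do ? congr (- _); congr (mxunit _ _ _ _); lia.
Qed.

(** On the rotation planes $J^2=-1$; off them $J=0$. *)
Lemma chev_diff_cube k : (1 <= k <= l)%N -> J k ^+ 3 = - J k.
Proof.
move=> hk; apply: eq_mxunit => c d hc.
rewrite exprS -mulmxE -mulmxA chev_diff_sqr_act // mulNmx.
case: ifP => h; first by rewrite mulmxN.
rewrite mulmx0 chev_diff_act //; decide_if.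
by rewrite oppr0.
Qed.

(** The permutation underlying both the quarter turn and $S^C_k$; at $k=1$ the order of the tests
    makes it the single transposition of $\ell$ and $\ell+1$. *)
Definition label_swap k c : nat :=
  if c == (l.+1 - k)%N then c.+1 else if c == (l.+2 - k)%N then c.-1
  else if c == (l + k).-1 then c.+1 else if c == (l + k)%N then c.-1 else c.

Lemma label_swapK k : (1 <= k <= l)%N -> involutive (label_swap k).
Proof.
move=> hk c; rewrite {2}/label_swap.
label_cases l k c; rewrite /label_swap; decide_if; lia.
Qed.

Lemma label_swap_range k c : (1 <= k <= l)%N -> (0 < c <= 2 * l)%N ->
  (0 < label_swap k c <= 2 * l)%N.
Proof.
by move=> hk hc; rewrite /label_swap; label_cases l k c; lia.
Qed.

Lemma rotation_act k : (1 <= k <= l)%N ->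
  monomial_action (1%:M + J k + J k ^+ 2)
    (fun c => if (c == (l.+2 - k)%N) || (c == (l + k)%N) then -1 else 1)
    (label_swap k).
Proof.
move=> hk c d hc; rewrite (mulmxDl (_ + J k)) (mulmxDl 1%:M) mul1mx.
rewrite chev_diff_act // chev_diff_sqr_act // /label_swap; label_cases l k c; decide_if.
all: by rewrite ?scaleN1r ?scale1r ?addr0 // addrAC subrr add0r.
Qed.

(** Only the signs differ from [rotation_act]: $T_\ell$ acts after the swap when $k=1$, and
    $\overline S_{\ell-1+k}$ negates both of its labels when $k>1$. *)
Lemma SC_act k : (1 <= k <= l)%N ->
  monomial_action (SC K l k)
    (fun c => if (c == (l + k)%N) || (c == (l + k).-1) && (k != 1%N) then -1 else 1)
    (label_swap k).
Proof.
move=> hk c d hc; rewrite /SC; case: (eqVneq k 1%N) => [k1|k1].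
  have hl : (0 < l < 2 * l)%N by lia.
  rewrite -mulmxA (Smx_act K hl) // scale1r Tmx_act; last by do 2? case: ifP; lia.
  rewrite /label_swap; label_cases l k c; decide_if; rewrite ?scaleN1r ?scale1r;
    do ? congr (- _); congr (mxunit _ _ _ _); lia.
have ha : (0 < l + 1 - k < 2 * l)%N by lia.
have hb : (0 < l - 1 + k < 2 * l)%N by lia.
rewrite -mulmxA (Sbarmx_act K hb) // -scalemxAr (Smx_act K ha); last by do 2? case: ifP; lia.
rewrite scale1r /label_swap; label_cases l k c; decide_if; rewrite ?scaleN1r ?scale1r.
all: by do ? congr (- _); congr (mxunit _ _ _ _); lia.
Qed.

End Chevalley.

(** Gives units with provably equal labels one syntactic form, so that [mxunit_ring] can generalize
    each to an atom. *)
Ltac merge_units := repeat match goal with |- context [mxunit ?K ?n ?a ?b] =>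
  match goal with |- context [mxunit K n ?c ?d] =>
    tryif (constr_eq a c; constr_eq b d) then fail else
    (rewrite (_ : mxunit K n a b = mxunit K n c d); last by congr (mxunit _ _ _ _); lia)
  end end.

Ltac mxunit_ring := merge_units; repeat move: (mxunit _ _ _ _) => ?;
  apply/matrixP => ? ?; rewrite !mxE; try ring.

Ltac expand_units := rewrite !(mulmxDl, mulmxDr, mulmxBl, mulmxBr, mulNmx, mulmxN,
  mul0mx, mulmx0, mul_mxunit); decide_if.

(** * Conjugation of the Chevalley generators by $S^C_i$ *)

Section AdjointAction.
Context (K : fieldType) (l : nat).
Local Notation E := (mxunit K (2 * l)).

Lemma AdD n (g A B : 'M[K]_n) : Ad g (A + B) = Ad g A + Ad g B.
Proof. by rewrite /Ad mulmxDr mulmxDl. Qed.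

Lemma Ad0 n (g : 'M[K]_n) : Ad g 0 = 0.
Proof. by rewrite /Ad mulmx0 mul0mx. Qed.

Context (i j : nat) (hi : (1 <= i <= l)%N) (hj : (1 <= j <= l)%N).
Context (SU : SC K l i \in unitmx).

Lemma Ad_SC_mxunit a b : (0 < a <= 2 * l)%N -> (0 < b <= 2 * l)%N ->
  Ad (SC K l i) (E a b) =
  ((if (a == (l + i)%N) || (a == (l + i).-1) && (i != 1%N) then -1 else 1) *
   (if (b == (l + i)%N) || (b == (l + i).-1) && (i != 1%N) then -1 else 1)) *:
  E (label_swap l i a) (label_swap l i b).
Proof.
move=> ha hb; rewrite (Ad_mxunit SU (SC_act K hi)) //.
- exact/inv_inj/label_swapK.
- by move=> c; exact: label_swap_range.
- by move=> c; case: ifP; rewrite ?mulrNN mulr1.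
Qed.

Local Notation S := (SC K l i).
Local Notation e := (chev_e K l).
Local Notation f := (chev_f K l).

(** Conjugation exchanges the two labels of each unit. Their signs agree when $i>1$ and are opposite
    when $i=1$. *)
Lemma Ad_SC_same : i = j ->
  Ad S (e j) = (-1) ^+ (i == 1%N) *: f j /\ Ad S (f j) = (-1) ^+ (i == 1%N) *: e j.
Proof.
move=> ij; rewrite -ij chev_e_sum // chev_f_sum //; split.
all: case: (eqVneq i 1%N) => i1; rewrite ?expr1 ?expr0 AdD ?Ad0 !Ad_SC_mxunit; try lia.
all: rewrite /label_swap; decide_if; mxunit_ring.
Qed.

(** The labels of index [j] are then disjoint from those that $S^C_i$ moves or negates. *)
Lemma Ad_SC_far : (i.+1 < j)%N || (j.+1 < i)%N ->
  Ad S (e j) = e j /\ Ad S (f j) = f j.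
Proof.
move=> ij; rewrite chev_e_sum // chev_f_sum //; split.
all: case: (eqVneq j 1%N) => j1; rewrite AdD ?Ad0 !Ad_SC_mxunit; try lia.
all: case: (eqVneq i 1%N) => i1; rewrite /label_swap; decide_if; mxunit_ring.
Qed.

(** Each unit of index [j] has exactly one label moved by $S^C_i$, and a single bracket shifts the
    same label. *)
Lemma Ad_SC_succ : j = i.+1 ->
  Ad S (e j) = - ad (e i) (e j) /\ Ad S (f j) = ad (f i) (f j).
Proof.
move=> ij; rewrite !chev_e_sum // !chev_f_sum //; split.
all: have j1 : (j == 1%N) = false by lia.
all: rewrite j1 AdD !Ad_SC_mxunit; try lia.
all: rewrite /ad; case: (eqVneq i 1%N) => i1; expand_units.
all: rewrite /label_swap; decide_if; mxunit_ring.
Qed.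

Lemma Ad_SC_pred : i = j.+1 -> j != 1%N ->
  Ad S (e j) = ad (e i) (e j) /\ Ad S (f j) = - ad (f i) (f j).
Proof.
move=> ij j1; rewrite !chev_e_sum // !chev_f_sum // (negbTE j1); split.
all: have i1 : (i == 1%N) = false by lia.
all: rewrite i1 AdD !Ad_SC_mxunit; try lia.
all: rewrite /ad; expand_units.
all: rewrite /label_swap; decide_if; mxunit_ring.
Qed.

(** Both labels of $e_1$ move. Since $e_2^2=0$, the double bracket is $-2e_2e_1e_2$, whence the
    factor 2, kept undivided over a general field. *)
Lemma Ad_SC_long : i = 2 -> j = 1%N ->
  ad (e i) (ad (e i) (e j)) = 2 *: Ad S (e j) /\
  ad (f i) (ad (f i) (f j)) = 2 *: Ad S (f j).
Proof.
move=> i2 j1; rewrite !chev_e_sum // !chev_f_sum //; split.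
all: have i1 : (i == 1%N) = false by lia.
all: rewrite i1 j1 eqxx !addr0 !Ad_SC_mxunit; try lia.
all: rewrite /ad; expand_units; rewrite ?(subr0, sub0r, addr0, add0r, oppr0); expand_units.
all: rewrite /label_swap; decide_if; mxunit_ring.
Qed.

End AdjointAction.

(** * Membership of $S^C_k$ in the Tits group, and of the Tits group in $Sp_{2\ell}$ *)

Section TitsGroup.
Context (R : realType) (l : nat).
Local Notation J k := (chev_f R[i] l k - chev_e R[i] l k).
Local Notation G k := (1%:M + J k + J k ^+ 2).

Lemma expmx_chev_diff k : (1 <= k <= l)%N -> expmx ((pi / 2)%:C%C *: J k) = G k.
Proof.
move=> hk; rewrite expmx_rotation; last exact: chev_diff_cube.
by rewrite sin_pihalf cos_pihalf subr0 !scale1r.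
Qed.

Lemma tits_rotation k : (1 <= k <= l)%N -> tits_group R l (G k).
Proof. by move=> hk; apply: gen_mem; exists k; rewrite ?expmx_chev_diff. Qed.

(** Two quarter turns make a half turn, which is $-1$ on the rotation planes. *)
Lemma rotation_sqr_act k : (1 <= k <= l)%N ->
  monomial_action (G k *m G k) (fun c => if [|| c == (l.+1 - k)%N,
    c == (l.+2 - k)%N, c == (l + k).-1 | c == (l + k)%N] then -1 else 1) id.
Proof.
move=> hk; have GG := monomial_mul (rotation_act R[i] hk) (rotation_act R[i] hk)
  (fun c => @label_swap_range l k c hk).
move=> c d hc; rewrite GG //=; rewrite label_swapK //; congr (_ *: _).
by rewrite /label_swap; label_cases l k c; decide_if; rewrite ?(mulr1, mul1r).
Qed.

(* The signs of [G_1^2], ..., [G_k^2] telescope: only those at the outermost labels survive. *)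
Lemma tits_sign k : (1 <= k <= l)%N -> exists2 g, tits_group R l g &
  monomial_action g (fun c => if (c == (l.+1 - k)%N) || (c == (l + k)%N) then -1 else 1) id.
Proof.
elim: k => // k IH hk; have GT := tits_rotation hk; have G2 := rotation_sqr_act hk.
have [k0|k0] := eqVneq k 0%N.
  (* For index 1 the inner and outer labels coincide, so the square alone has the required signs. *)
  exists (G k.+1 *m G k.+1); first exact: gen_mul.
  move=> c d hc; rewrite G2 //; congr (_ *: _); rewrite k0.
  by label_cases l 1%N c; decide_if.
have [g gT gE] : exists2 g, tits_group R l g & monomial_action g _ _ := IH ltac:(lia).
exists (g *m (G k.+1 *m G k.+1)); first by apply: gen_mul => //; exact: gen_mul.
move=> c d hc; rewrite -mulmxA G2 // -scalemxAr gE // scalerA; congr (_ *: _).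
by label_cases l k.+1 c; decide_if; rewrite ?(mulr1, mul1r, mulrNN).
Qed.

Lemma tits_SC k : (1 <= k <= l)%N -> tits_group R l (SC R[i] l k).
Proof.
move=> hk; have GT := tits_rotation hk; have GE := rotation_act R[i] hk.
have [k1|k1] := eqVneq k 1%N.
  suff -> : SC R[i] l k = G k by [].
  apply: (eq_monomial (SC_act _ hk) GE) => // c hc; rewrite k1.
  by label_cases l 1%N c; decide_if.
have [g gT gE] := tits_sign hk.
(* Acting after the quarter turn, [g] cancels its sign at $\ell+2-k$ and adds one at $\ell+k-1$. *)
suff -> : SC R[i] l k = g *m G k by exact: gen_mul.
apply: (eq_monomial (SC_act _ hk) (monomial_mul gE GE _)) => // c hc.
  exact: label_swap_range.
by rewrite /label_swap; label_cases l k c; decide_if; rewrite ?(mulr1, mul1r, mulrNN).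
Qed.

Lemma tits_Sp : tits_group R l `<=` Sp R[i] l.
Proof.
move=> g; elim=> [{}g [k hk <-]||g' h _ + _|g' _].
- rewrite expmx_chev_diff //; apply: Sp_quarter_turn; last exact: chev_diff_cube.
  by apply: spB; [exact: chev_f_sp | exact: chev_e_sp].
- exact: Sp_one.
- exact: Sp_mul.
- exact: Sp_inv.
Qed.

End TitsGroup.

(** * Assembly of the formulas with the Cartan integers *)

Unset Implicit Arguments.
Set Strict Implicit.

Theorem proposition9p4 (R : realType) (l : nat) (hl : (1 <= l)%N)
    (i j : nat) (hi : (1 <= i <= l)%N) (hj : (1 <= j <= l)%N) :
  let C : fieldType := R[i] in
  let S := SC C l i in
  let e := chev_e C l in
  let f := chev_f C l in
  let a := cartan i j in
  [/\ tits_group R l S, tits_group R l `<=` Sp C l,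
      (forall X, sp C l X -> sp C l (Ad S X)),
      sp C l (e j) & sp C l (f j)] /\
  [/\ i = j -> Ad S (e j) = (-1) ^+ (i == 1%N) *: f j,
      1 < `|i%:Z - j%:Z| -> Ad S (e j) = e j,
      i%:Z - j%:Z = -1 -> Ad S (e j) = - ad (e i) (e j)
    & i%:Z - j%:Z = 1 ->
        Ad S (e j) = (`|a|%N`!)%:R^-1 *: iter `|- a|%N (ad (e i)) (e j)] /\
  [/\ i = j -> Ad S (f j) = (-1) ^+ (i == 1%N) *: e j,
      1 < `|i%:Z - j%:Z| -> Ad S (f j) = f j,
      i%:Z - j%:Z = -1 -> Ad S (f j) = iter `|- a|%N (ad (f i)) (f j)
    & i%:Z - j%:Z = 1 ->
        Ad S (f j) = ((-1) ^+ `|a|%N / (`|a|%N`!)%:R) *: iter `|- a|%N (ad (f i)) (f j)].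
Proof.
move=> C S e f a.
have ST : tits_group R l S by exact: tits_SC.
have SS : Sp C l S by exact: tits_Sp.
have [SU _] := SS.
(* Allows division by $2!$ in the case $(i,j)=(2,1)$. *)
have C2 : (2 : C) != 0 by rewrite pnatr_eq0.
split.
  split=> //; [exact: tits_Sp | | exact: chev_e_sp | exact: chev_f_sp].
  by move=> X; exact: Ad_sp.
have far : 1 < `|i%:Z - j%:Z| -> (i.+1 < j)%N || (j.+1 < i)%N by lia.
have succ : i%:Z - j%:Z = -1 -> j = i.+1 by lia.
have pred : i%:Z - j%:Z = 1 -> i = j.+1 by lia.
have aS : j = i.+1 -> a = -1.
  by move=> ij; rewrite /a /cartan ij; decide_if; case: ifP.
(* Below the diagonal, $-2$ occurs only at $(2,1)$; this separates the double bracket from the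
   single one. *)
have aP : i = j.+1 -> a = if j == 1%N then - 2 else -1.
  move=> ij; rewrite /a /cartan ij; case: (eqVneq j 1%N) => j1; decide_if => //.
have long : i = j.+1 -> j == 1%N ->
  ad (e i) (ad (e i) (e j)) = 2 *: Ad S (e j) /\ ad (f i) (ad (f i) (f j)) = 2 *: Ad S (f j).
  by move=> ij /eqP j1; apply: Ad_SC_long => //; rewrite ij j1.
split; split=> ij.
- by case: (Ad_SC_same hi hj SU ij).
- by case: (Ad_SC_far hi hj SU (far ij)).
- by case: (Ad_SC_succ hi hj SU (succ ij)).
- rewrite (aP (pred ij)); case: (boolP (j == 1%N)) => j1 /=.
    by case: (long (pred ij) j1) => -> _; rewrite scalerA mulVf // scale1r.
  by case: (Ad_SC_pred hi hj SU (pred ij) j1) => -> _; rewrite invr1 scale1r.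
- by case: (Ad_SC_same hi hj SU ij).
- by case: (Ad_SC_far hi hj SU (far ij)).
- by rewrite (aS (succ ij)); case: (Ad_SC_succ hi hj SU (succ ij)).
- rewrite (aP (pred ij)); case: (boolP (j == 1%N)) => j1 /=.
    by case: (long (pred ij) j1) => _ ->; rewrite scalerA sqrrN expr1n mul1r mulVf // scale1r.
  by case: (Ad_SC_pred hi hj SU (pred ij) j1) => _ ->; rewrite expr1 divr1 scaleN1r.
Qed.
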